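(* Assume the principle $\clubsuit^\ast$ holds. Then there exists a first countable, locally compact Dowker space that is not semi-proximal.
   Context: $\clubsuit^\ast$ is the statement that there exists a sequence $\{C_\alpha : \alpha\in\mathrm{Lim}(\omega_1)\}$ (indexed by the limit ordinals below $\omega_1$), where each $C_\alpha\subset\alpha$ has order type $\omega$ and $\sup(C_\alpha)=\alpha$, such that for every uncountable subset $A$ of $\omega_1$, the set $\{\alpha<\omega_1 : |A\cap C_\alpha|=\omega\}$ contains a club (closed unbounded subset of $\omega_1$). A Dowker space is a normal (Hausdorff) space whose product with the convergent sequence $\omega+1$ (order topology) is not normal; equivalently, a normal space that is not countably paracompact. The proximal game on a uniform space $(X,\mathfrak U)$ (where $\mathfrak U$ is a uniformity or a base for a uniformity): in inning $0$, Player I chooses an entourage $U_0\in\mathfrak U$ and Player II chooses $x_0\in X$. In inning $n+1$, Player I chooses an entourage $U_{n+1}\in\mathfrak U$ with $U_{n+1}\subseteq U_n$ and Player II chooses $x_{n+1}\in U_n[x_n]=\{y\in X:\langle x_n,y\rangle\in U_n\}$. Player I wins if either $\bigcap_{n<\omega}U_n[x_n]=\emptyset$ or the sequence $(x_n:n<\omega)$ converges in $X$; otherwise Player II wins. A space $X$ is semi-proximal if there is a uniformity $\mathfrak U$ on $X$ compatible with its topology such that Player II has no winning strategy in the proximal game on $(X,\mathfrak U)$. *)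

(* Defs.v *)
From HB Require Import structures.
From mathcomp Require Import all_boot all_order.
From mathcomp Require Import all_classical topology.

Set Implicit Arguments.
Unset Strict Implicit.
Unset Printing Implicit Defensive.

Local Open Scope order_scope.
Local Open Scope card_scope.
Local Open Scope classical_set_scope.

Section Omega1.
Context {d : Order.disp_t} (W : orderType d).
Implicit Types (a b c : W) (A C D : set W).

(* This determines [W] up to order isomorphism. *)
Definition is_omega1 : Prop :=
  [/\ wochoice.well_order (<=%O : rel W),
      ~ countable [set: W] &
      forall a, countable [set b | b < a]].

(* The least element is not counted as a limit. *)
Definition limit_ordinal a : Prop :=
  (exists b, b < a) /\ forall b, b < a -> exists c, b < c < a.

Definition order_type_omega C : Prop :=
  exists f : nat -> W, {homo f : m n / (m < n)%N >-> m < n} /\ range f = C.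

Definition club D : Prop :=
  closed (D : set (order_topology W)) /\ forall a, exists2 b, D b & a < b.

(* The values of [C] outside the limit ordinals are irrelevant. *)
Definition club_star : Prop :=
  exists C : W -> set W,
    (forall a, limit_ordinal a ->
       [/\ C a `<=` [set b | b < a], order_type_omega (C a) &
           supremums (C a) a]) /\
    forall A, ~ countable A ->
      exists2 D, club D &
        D `<=` [set a | limit_ordinal a /\ A `&` C a #= [set: nat]].

End Omega1.

(* The ordinal omega + 1, [None] being the top element omega. *)
Definition omega_plus_one : Type := option nat.

HB.instance Definition _ := Choice.on omega_plus_one.

Section OmegaPlusOne.

Definition le_omega_plus_one (x y : omega_plus_one) : bool :=
  match x, y with
  | _, None => true
  | None, Some _ => false
  | Some m, Some n => (m <= n)%N
  end.

Fact le_omega_plus_one_refl : reflexive le_omega_plus_one.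
Proof. by case=> [n|] /=. Qed.

Fact le_omega_plus_one_anti : antisymmetric le_omega_plus_one.
Proof. by move=> [m|] [n|] //= /anti_leq ->. Qed.

Fact le_omega_plus_one_trans : transitive le_omega_plus_one.
Proof. by move=> [m|] [n|] [p|] //=; exact: leq_trans. Qed.

Fact le_omega_plus_one_total : total le_omega_plus_one.
Proof. by move=> [m|] [n|] //=; exact: leq_total. Qed.

End OmegaPlusOne.

HB.instance Definition _ :=
  Order.Le_isPOrder.Build Order.default_display omega_plus_one
    le_omega_plus_one_refl le_omega_plus_one_anti le_omega_plus_one_trans.

HB.instance Definition _ :=
  Order.POrder_isTotal.Build Order.default_display omega_plus_one
    le_omega_plus_one_total.

Section Spaces.
Variable X : topologicalType.

Definition first_countable : Prop :=
  forall x : X, exists2 B : set (set X), countable B &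
    B `<=` nbhs x /\ forall U, nbhs x U -> exists2 V, B V & V `<=` U.

(* [normal_space] does not include any separation of points. *)
Definition Dowker_space : Prop :=
  [/\ hausdorff_space X, normal_space X &
      ~ normal_space (X * order_topology omega_plus_one)%type].

(* The axioms of [uniformType], for a topology on [X] given beforehand. *)
Definition compatible_uniformity (E : set_system (X * X)) : Prop :=
  [/\ Filter E,
      forall U, E U -> diagonal `<=` U,
      forall U, E U -> E (U^-1)%relation,
      forall U, E U -> exists2 V, E V & (V \; V)%relation `<=` U &
      @nbhs X X = nbhs_ E].

(* Since a strategy fixes Player II's own past moves, it only has to depend on
   the finite sequence U_0, ..., U_n of entourages played so far by Player I. *)
Definition strategyII : Type := seq (set (X * X)) -> X.

Definition playII (s : strategyII) (U : nat -> set (X * X)) (n : nat) : X :=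
  s (mkseq U n.+1).

Definition legalI (E : set_system (X * X)) (U : nat -> set (X * X)) : Prop :=
  (forall n, E (U n)) /\ forall n, U n.+1 `<=` U n.

Definition legalII (U : nat -> set (X * X)) (x : nat -> X) : Prop :=
  forall n, xsection (U n) (x n) (x n.+1).

Definition winsI (U : nat -> set (X * X)) (x : nat -> X) : Prop :=
  \bigcap_n xsection (U n) (x n) = set0 \/ exists l : X, x @ \oo --> l.

Definition winningII (E : set_system (X * X)) (s : strategyII) : Prop :=
  forall U, legalI E U ->
    legalII U (playII s U) /\ ~ winsI U (playII s U).

Definition semi_proximal : Prop :=
  exists2 E, compatible_uniformity E & ~ exists s, winningII E s.

End Spaces.

(* Main.v *)
Require Import Defs.
From HB Require Import structures.
From mathcomp Require Import all_boot all_order.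
From mathcomp Require Import interval all_classical topology.

(** A variant of de Caux's space on [W * nat], where the club-star ladder at a
limit [a] makes the points [(c a k, n)] converge to [(a, n + 1)].  If a closed
set is unbounded on level [n], then club-star puts [(a, n + 1)] in it for club
many [a], and so on at all higher levels.  Hence two unbounded closed sets
meet, and of two disjoint closed sets one lives on a countable clopen initial
part of the space, where separation is easy: the space is normal.  For the same
reason an open set containing all levels from [n] on is cobounded, so that the
intersection of countably many of these is nonempty: the space is not countably
paracompact.  Finally, every entourage [U] of a compatible uniformity contains
the square of a final part of the space.  Player II always moves beyond these
thresholds, which keeps [\bigcap_n U_n[x_n]] nonempty, and climbs one level per
inning, which prevents convergence since [(a, n)] has neighbourhoods inside the
levels up to [n]. *)

Set Implicit Arguments.
Unset Strict Implicit.
Unset Printing Implicit Defensive.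

Import Order.TTheory.

Local Open Scope order_scope.
Local Open Scope card_scope.
Local Open Scope classical_set_scope.

(** * Countable sets, closure points and clubs in omega_1 *)

Section Omega1Theory.
Context {d : Order.disp_t} (W : orderType d).
Hypothesis hW : is_omega1 W.
Implicit Types (a b : W) (A : set W).

Lemma omega1_least A : A !=set0 -> exists2 a, A a & lbound A a.
Proof.
case: hW => wo _ _ [b Ab].
have [|a [[aA amin] _]] := wo [pred x | `[< A x >]].
  by exists b; apply/asboolP.
exists a; first by apply/asboolP.
by move=> x Ax; apply: amin; apply/asboolP.
Qed.

Lemma omega1_nonempty : [set: W] !=set0.
Proof. by apply/set0P/eqP => W0; case: hW => _ + _; rewrite W0; apply. Qed.

Lemma omega1_countable_lt a : countable [set b | b < a].
Proof. by case: hW. Qed.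

Lemma omega1_countable_le a : countable [set b | b <= a].
Proof.
apply: (@sub_countable _ _ _ ([set a] `|` [set b | b < a])).
  by apply: subset_card_le => b /=; rewrite le_eqVlt => /orP[/eqP|]; [left|right].
rewrite -bigcup2E; apply: bigcup_countable => // -[|[|i]] _ //=.
exact: omega1_countable_lt.
Qed.

(** Otherwise [W] would be a countable union of countable initial segments. *)
Lemma omega1_countable_bounded A : countable A -> exists a, forall b, A b -> b < a.
Proof.
move=> cA; apply: contrapT => /forallNP unb; case: hW => _ + _; apply.
apply: (@sub_countable _ _ _ (\bigcup_(a in A) [set b | b <= a])); last first.
  by apply: bigcup_countable => // a _; exact: omega1_countable_le.
apply: subset_card_le => b _; have /existsNP[a /not_implyP[Aa]] := unb b.
by move/negP; rewrite -leNgt => ba; exists a.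
Qed.

(** The witness is the supremum of the iterates at [a0] of a map [g] for which [g a] exceeds [a] and
    all values of [f] up to [a]; such a [g] exists because initial segments are countable. *)
Lemma omega1_limit_closed (f : W -> W) a0 :
  exists a, [/\ a0 < a, limit_ordinal a & forall b, b < a -> f b < a].
Proof.
have /choice[g gP] : forall a, exists b, a < b /\ forall x, x <= a -> f x < b.
  move=> a; have cS : countable (f @` [set x | x <= a] `|` [set a]).
    rewrite -bigcup2E; apply: bigcup_countable => // -[|[|i]] _ //=.
    by apply: sub_countable (card_image_le _ _) _; exact: omega1_countable_le.
  have [b bP] := omega1_countable_bounded cS.
  exists b; split; first by apply: bP; right.
  by move=> x xa; apply: bP; left; exists x.
pose s n := iter n g a0.
have sS n : s n < s n.+1 by have [] := gP (s n).
have cs : countable (range s) by exact: sub_countable (card_image_le _ _) _.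
have [m mP] := omega1_countable_bounded cs.
have [|a aub amin] := @omega1_least (ubound (range s)).
  by exists m => _ [n _ <-]; apply/ltW/mP; exists n.
have sa n : s n < a by rewrite (lt_le_trans (sS n))// aub//; exists n.+1.
have below b : b < a -> exists n, b < s n.
  move=> ba; apply: contrapT => /forallNP h.
  suff : ubound (range s) b by move=> /amin; rewrite leNgt ba.
  by move=> _ [n _ <-]; rewrite leNgt; exact/negP/h.
exists a; split; first exact: (sa 0%N).
  split; first by exists a0; exact: (sa 0%N).
  by move=> b /below[n bn]; exists (s n); rewrite bn sa.
move=> b /below[n bn]; rewrite (lt_trans _ (sa n.+1))//.
by have [_] := gP (s n); apply; exact: ltW.
Qed.

(** A point closed under a next-element map of each club is the supremum of the elements of that
    club up to it, so it lies in both. *)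
Lemma club_meet (D E : set W) : club D -> club E -> D `&` E !=set0.
Proof.
move=> [cD uD] [cE uE].
have /choice[f fP] a : exists b, D b /\ a < b by have [b] := uD a; exists b.
have /choice[g gP] a : exists b, E b /\ a < b by have [b] := uE a; exists b.
have [a0 _] := omega1_nonempty.
have ca a : closed ([set b | b <= a] : set (order_topology W)).
  by have := @lray_closed _ (order_topology W) a; rewrite set_itvE.
have [a [a0a _ acl]] := omega1_limit_closed (fun b => Order.max (f b) (g b)) a0.
have mem F (h : W -> W) : closed (F : set (order_topology W)) ->
    (forall b, F (h b) /\ b < h b) -> (forall b, b < a -> h b < a) -> F a.
  move=> cF hP ha; pose A : set (order_topology W) := F `&` [set b | b <= a].
  suff [] : A a by [].
  apply: (@itv_closed_supremums _ (order_topology W)).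
  - exists (h a0); split; first by have [] := hP a0.
    exact: (ltW (ha _ a0a)).
  - by exact: closedI.
  - split=> [b [_] | b bub]; first by [].
    rewrite leNgt; apply/negP => ba; have [Fb lb] := hP b.
    have : A (h b) by split=> //; exact: (ltW (ha _ ba)).
    by move=> /bub; rewrite leNgt lb.
exists a; split.
- by apply: (mem _ f) => // b /acl; rewrite gt_max => /andP[].
- by apply: (mem _ g) => // b /acl; rewrite gt_max => /andP[].
Qed.

End Omega1Theory.

(** * The ladder topology and its local properties *)

Section LadderSpace.
Context {d : Order.disp_t} (W : orderType d).

(** The alias records [c], so that a topology depending on the ladders can be attached to the
    product as an instance. *)
Definition ladder_space (c : W -> nat -> W) : Type := (W * nat)%type.

Variable c : W -> nat -> W.
Implicit Types (a b : W) (k n : nat).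

HB.instance Definition _ := Choice.on (ladder_space c).

(* In [fan n.+1 a], only the part of [fan n (c a k)] beyond all earlier [c a i]
is kept: these pieces lie in disjoint intervals of first coordinates, and their
only accumulation point outside their union is [(a, n.+1)]. *)
Fixpoint fan n a : set (ladder_space c) :=
  if n is m.+1 then
    (a, n) |` [set x | limit_ordinal a /\
                exists k, fan m (c a k) x /\ forall i, (i < k)%N -> c a i < x.1]
  else [set (a, 0%N)].

(* Asking only for the points [(c a k, n)] with [k] large, instead of their whole
fans, would give a topology that is not first countable. *)
Definition ladder_open (O : set (ladder_space c)) : Prop :=
  forall a n, O (a, n) -> limit_ordinal a ->
    exists2 b, b < a & forall x, fan n a x -> b < x.1 -> O x.

Lemma fan_top n a : fan n a (a, n).
Proof. by case: n => [|n] //=; left. Qed.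

Let ladder_openT : ladder_open setT.
Proof. by move=> a n _ [[b ba] _]; exists b. Qed.

Let ladder_openI : setI_closed ladder_open.
Proof.
move=> A B oA oB a n [Aa Ba] la.
have [b ba bA] := oA a n Aa la; have [b' b'a bB] := oB a n Ba la.
exists (Order.max b b'); first by rewrite gt_max ba.
by move=> x fx; rewrite gt_max => /andP[bx b'x]; split; [exact: bA|exact: bB].
Qed.

Let ladder_open_bigU (I : Type) (f : I -> set (ladder_space c)) :
  (forall i, ladder_open (f i)) -> ladder_open (\bigcup_i f i).
Proof.
move=> of_ a n [i _ fi] la; have [b ba bP] := of_ i a n fi la.
by exists b => // x fx bx; exists i => //; exact: bP.
Qed.

HB.instance Definition _ := isOpenTopological.Build (ladder_space c)
  ladder_openT ladder_openI ladder_open_bigU.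

Lemma ladder_openE (O : set (ladder_space c)) : open O = ladder_open O.
Proof. by []. Qed.

Local Notation X := (ladder_space c).

Definition above a : set X := [set x | a < x.1].
Definition below a : set X := [set x | x.1 <= a].

Lemma aboveC a : ~` above a = below a.
Proof.
by apply/seteqP; split=> x; rewrite /above /below /setC /= leNgt => /negP.
Qed.

Lemma belowC a : ~` below a = above a.
Proof. by rewrite -aboveC setCK. Qed.

Lemma open_above a : open (above a).
Proof. by rewrite ladder_openE => b n ab _; exists a. Qed.

Lemma closed_below a : closed (below a).
Proof. rewrite -aboveC; apply: open_closedC; exact: open_above. Qed.

Definition levels n : set X := [set x | (x.2 <= n)%N].

Hypothesis c_lt : forall a k, limit_ordinal a -> c a k < a.
Hypothesis c_cofinal : forall a b, limit_ordinal a -> b < a -> exists k, b < c a k.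

(** Descending along ladders lowers both coordinates; this is why [below a] and [levels n] are
    open. *)
Lemma fan_below n a x : fan n a x -> x = (a, n) \/ x.1 < a /\ (x.2 < n)%N.
Proof.
elim: n a => [|n IH] a /=; first by left.
move=> [->|[la [k [/IH xk _]]]]; [by left | right].
case: xk => [->|[xk xn]] /=; first by split=> //; exact: c_lt.
by split; [exact: lt_trans xk (c_lt _ la) | exact: leqW].
Qed.

Lemma open_below a : open (below a).
Proof.
rewrite ladder_openE => b n ba [[e eb] _]; exists e => // x /fan_below[->|[xb _]] _ //.
exact: ltW (lt_le_trans xb ba).
Qed.

Lemma closed_above a : closed (above a).
Proof. rewrite -belowC; apply: open_closedC; exact: open_below. Qed.

Lemma open_levels n : open (levels n).
Proof.
rewrite ladder_openE => b m bm [[e eb] _]; exists e => // x /fan_below[->|[_ xm]] _ //.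
exact: leq_trans (ltnW xm) bm.
Qed.

Lemma open_rung a k : open [set x : X | forall i, (i < k)%N -> c a i < x.1].
Proof.
rewrite ladder_openE; elim: k => [|k IH] b n.
  by move=> _ [[e eb] _]; exists e.
move=> h lb; have [|e eb eP] := IH b n _ lb; first by move=> i ik; apply/h/ltnW.
exists (Order.max e (c a k)); first by rewrite gt_max eb h.
move=> x fx; rewrite gt_max => /andP[ex kx] i.
by rewrite ltnS leq_eqVlt => /orP[/eqP -> //|ik]; exact: eP.
Qed.

Lemma closed_rung a k : closed [set x : X | forall i, (i < k)%N -> c a i < x.1].
Proof.
rewrite [X in closed X](_ : _ = \bigcap_(i in `I_k) above (c a i)).
  by apply: closed_bigI => i _; exact: closed_above.
by apply/seteqP; split=> x.
Qed.

Lemma open_fan n a : open (fan n a).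
Proof.
elim: n a => [|n IH] a.
  by rewrite ladder_openE => b m [-> ->] [[e ea] _]; exists e.
rewrite ladder_openE => b m [[-> ->] [[e ea] _]|]; first by exists e.
move=> [la [k [fk ck]]] lb.
have := openI (IH (c a k)) (@open_rung a k).
rewrite ladder_openE => /(_ b m (conj fk ck) lb)[e eb eP].
by exists e => // x fx ex; right; split=> //; exists k; apply: eP.
Qed.

(** Fans are open themselves, so the fans cut by [above b] form a base at their top; over a
    non-limit every point is isolated. *)
Lemma ladder_nbhsE (x : X) (A : set X) : nbhs x A <->
  A x /\ (limit_ordinal x.1 ->
    exists2 b, b < x.1 & fan x.2 x.1 `&` above b `<=` A).
Proof.
case: x => a n; split=> [|[Aa h]].
  rewrite nbhsE => -[O [oO Oa] OA]; split; first exact: OA.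
  by move=> la; have [b ba bO] := oO a n Oa la; exists b => // x [fx bx]; exact/OA/bO.
have [la|nla] := pselect (limit_ordinal a).
  have [b ba bA] := h la; apply: filterS bA _; apply: open_nbhs_nbhs; split.
    by apply: openI; [exact: open_fan|exact: open_above].
  by split=> //; exact: fan_top.
rewrite nbhsE; exists [set (a, n)]; last by move=> _ ->.
by split=> //; rewrite ladder_openE => b m [-> ->].
Qed.

(** The [k]-th piece of either fan has first coordinates beyond all [c a i] with [i < k] and at most
    [c a k]. A common point thus lies in pieces of equal index, and induction applies. This
    separates points of the same column. *)
Lemma fan_disjoint m n a x : fan m a x -> fan n a x -> m = n.
Proof.
have self j k b : fan j b (b, k) -> k = j.
  by move=> /fan_below[[]//|[]]; rewrite ltxx.
elim: m n a x => [|m IH] [|n] a x //.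
- by move=> -> /self.
- by move=> /[swap] -> /self.
move=> fm fn; case: (fm) => [xE|[la [k [fk ck]]]].
  by move: fn; rewrite xE => /self.
case: fn => [xE|[_ [l [fl cl]]]].
  by move: fm; rewrite xE => /self.
have le j i y : fan j (c a i) y -> y.1 <= c a i.
  by move=> /fan_below[->//|[/ltW]].
have [kl|lk|kl] := ltngtP k l.
- by have := cl _ kl; rewrite ltNge (le _ _ _ fk).
- by have := ck _ lk; rewrite ltNge (le _ _ _ fl).
- by rewrite kl in fk; rewrite (IH _ _ _ fk fl).
Qed.

Lemma ladder_hausdorff : hausdorff_space X.
Proof.
rewrite open_hausdorff => -[a m] [b n] ne.
wlog ab : a b m n ne / a <= b.
  move=> H; have [ab|/ltW ba] := leP a b; first exact: H.
  have [|[A B] [/= bA aB] [oA oB AB]] := H b a n m _ ba; first by rewrite eq_sym.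
  by exists (B, A) => //=; split=> //; rewrite setIC.
have [eab|nab] := eqVneq a b.
  rewrite -{}eab {ab b} in ne *.
  exists (fan m a, fan n a) => /=; first by rewrite !inE; split; exact: fan_top.
  split; [exact: open_fan|exact: open_fan|].
  apply/eqP; rewrite -subset0 => x [fm fn]; move: ne.
  by rewrite (fan_disjoint fm fn) eqxx.
exists (below a, above a) => /=; first by rewrite !inE /below /above /= lexx lt_neqAle nab ab.
split; [exact: open_below|exact: open_above|].
by rewrite -aboveC setICl.
Qed.

(** If [b < c a k], the pieces of index greater than [k] lie beyond [c a k], hence outside
    [below b]; piece [k] itself may still count. *)
Lemma fan_below_finite n a b : limit_ordinal a -> b < a ->
  exists k, fan n.+1 a `&` below b =
    \big[setU/set0]_(i < k)
      (fan n (c a i) `&` [set x | forall j, (j < i)%N -> c a j < x.1] `&` below b).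
Proof.
move=> la ba; have [k bk] := c_cofinal la ba; exists k.+1.
rewrite -(bigcup_mkord k.+1 (fun i => fan n (c a i) `&`
  [set x | forall j, (j < i)%N -> c a j < x.1] `&` below b)).
apply/seteqP; split=> x.
  move=> [[->|[_ [i [fi ci]]]]]; rewrite /below /=; first by rewrite leNgt ba.
  move=> xb; exists i => //=; rewrite ltnS leqNgt; apply/negP => ki.
  by have := ci _ ki; rewrite ltNge (le_trans xb (ltW bk)).
by move=> [i _ [[fi ci] xb]]; split=> //; right; split=> //; exists i.
Qed.

(** Induction on the level: a filter on the fan that does not cluster at the top contains a part
    lying in some [below b], which is a finite union of compact pieces. *)
Lemma fan_compact n a : compact (fan n a).
Proof.
elim: n a => [|n IH] a /=; first exact: compact_set1.
have [la|nla] := pselect (limit_ordinal a); last first.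
  rewrite [X in compact X](_ : _ = [set (a, n.+1)]); first exact: compact_set1.
  by apply/seteqP; split=> [x [|[]]//|_ ->]; left.
move=> F PF FT; apply: contrapT => noc.
have ncl : ~ cluster F (a, n.+1).
  by move=> cl; apply: noc; exists (a, n.+1); split=> //; left.
have [A [B [FA nB AB]]] : exists A B, [/\ F A, nbhs ((a, n.+1) : X) B & A `&` B = set0].
  apply: contrapT => h; apply: ncl => A B FA nB; apply/set0P/eqP => AB; apply: h.
  by exists A, B.
move: nB => /ladder_nbhsE[_ /(_ la)[b /= ba bB]].
have Fb : F (fan n.+1 a `&` below b).
  apply: filterS (filterI FT FA) => x [fx Ax]; split=> //.
  rewrite -aboveC => bx.
  have : (A `&` B) x by split=> //; exact: bB.
  by rewrite AB.
have : compact (fan n.+1 a `&` below b).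
  have [k ->] := fan_below_finite n la ba.
  apply: bigsetU_compact => i _; apply: compact_closedI; last exact: closed_below.
  exact: compact_closedI (IH _) (@closed_rung _ _).
by move=> /(_ F PF Fb)[x [[fx _] xF]]; apply: noc; exists x.
Qed.

Lemma fan_closed n a : closed (fan n a).
Proof. exact: compact_closed ladder_hausdorff (@fan_compact n a). Qed.

Lemma ladder_locally_compact : locally_compact [set: X].
Proof.
move=> -[a n] _; rewrite withinET; exists (fan n a).
  by apply: open_nbhs_nbhs; split; [exact: open_fan|exact: fan_top].
by split; [exact: fan_compact|exact: fan_closed].
Qed.

Lemma ladder_first_countable : first_countable X.
Proof.
move=> [a n]; have [la|nla] := pselect (limit_ordinal a).
  exists (range (fun k => fan n a `&` above (c a k))).
    exact: sub_countable (card_image_le _ _) _.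
  split=> [_ [k _ <-]|U /ladder_nbhsE[_ /(_ la)[b /= ba bU]]].
    apply/ladder_nbhsE; split; first by split; [exact: fan_top|exact: c_lt].
    by exists (c a k) => //; exact: c_lt.
  have [k bk] := c_cofinal la ba.
  exists (fan n a `&` above (c a k)); first by exists k.
  by move=> x [fx kx]; apply: bU; split=> //; exact: lt_trans bk kx.
exists [set [set (a, n)]]; first exact: countable1.
split=> [_ ->|U /ladder_nbhsE[Ua _]]; first by apply/ladder_nbhsE.
by exists [set (a, n)] => // _ ->.
Qed.

Lemma ladder_clopen_base (x : X) (U : set X) : nbhs x U ->
  exists V, [/\ clopen V, V x & V `<=` U].
Proof.
case: x => a n /ladder_nbhsE[Ua h].
have [la|nla] := pselect (limit_ordinal a).
  have [b ba bU] := h la; exists (fan n a `&` above b); split=> //.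
    apply: clopenI; split.
    - exact: open_fan.
    - exact: fan_closed.
    - exact: open_above.
    - exact: closed_above.
  by split=> //; exact: fan_top.
exists [set (a, n)]; split=> //; last by move=> _ ->.
split; first by rewrite ladder_openE => b m [-> ->].
exact: compact_closed ladder_hausdorff (@compact_set1 _ _).
Qed.

End LadderSpace.

(** * Separation of closed sets in general spaces *)

Lemma normal_space_separation (X : topologicalType) :
  (forall A B : set X, closed A -> closed B -> A `&` B = set0 ->
    exists U V, [/\ open U, open V, A `<=` U, B `<=` V & U `&` V = set0]) ->
  normal_space X.
Proof.
move=> sep A cA B nB.
have [||U [V [oU oV AU BV UV]]] := sep A (~` B^°) cA.
- by apply: open_closedC; exact: open_interior.
- by rewrite -subset0 => x [/nB Bx]; exact.
exists U; first by move=> x /AU Ux; exact: open_nbhs_nbhs.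
apply: (@subset_trans _ (~` V)).
  have cV : closed (~` V) by exact: open_closedC.
  rewrite (closure_id (~` V)).1//; apply: closureS.
  by move=> x Ux Vx; have : (U `&` V) x by []; rewrite UV.
by move=> x nVx; apply: interior_subset; apply: contrapT => /BV.
Qed.

(** Cover the countable set [A] together with [B] by a sequence of clopen sets, each missing [A] or
    [B], and make the sequence disjoint by removing earlier members. *)
Lemma countable_closed_separation (X : topologicalType) (A B : set X) :
  (forall (x : X) (U : set X), nbhs x U -> exists V, [/\ clopen V, V x & V `<=` U]) ->
  countable A -> countable B -> closed A -> closed B -> A `&` B = set0 ->
  exists U V, [/\ open U, open V, A `<=` U, B `<=` V & U `&` V = set0].
Proof.
move=> base ctA ctB clA clB AB.
have /choice[G GP] (x : X) : exists V, [/\ clopen V, V x & V `&` A = set0 \/ V `&` B = set0].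
  have [Ax|nAx] := pselect (A x).
    have nBx : ~ B x by move=> Bx; have : (A `&` B) x by []; rewrite AB.
    have [|V [cV Vx VB]] := base x (~` B).
      by apply: open_nbhs_nbhs; split=> //; exact: closed_openC.
    by exists V; split=> //; right; rewrite -subset0 => y [/VB].
  have [|V [cV Vx VA]] := base x (~` A).
    by apply: open_nbhs_nbhs; split=> //; exact: closed_openC.
  by exists V; split=> //; left; rewrite -subset0 => y [/VA].
have /countable_injP[f finj] : countable (A `|` B).
  by rewrite -bigcup2E; apply: bigcup_countable => // -[|[|i]] _ /=.
pose C n := \bigcup_(x in [set x | (A `|` B) x /\ f x = n]) G x.
have CE n : C n = set0 \/ exists x, C n = G x.
  have [[x [ABx fx]]|no] := pselect (exists x, (A `|` B) x /\ f x = n).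
    right; exists x; apply/seteqP; split=> [y [z [ABz fz]]|y Gy]; last by exists x.
    suff -> : z = x by [].
    by apply: finj; rewrite ?inE// fz.
  by left; rewrite -subset0 => y [z zP]; case: no; exists z.
have cC n : clopen (C n).
  by have [->|[x ->]] := CE n; [exact: clopen0|have [] := GP x].
have dC n : C n `&` A = set0 \/ C n `&` B = set0.
  have [->|[x ->]] := CE n; first by left; rewrite set0I.
  by have [] := GP x.
have cover x : (A `|` B) x -> C (f x) x.
  by move=> ABx; exists x => //; have [] := GP x.
pose D n := C n `\` \bigcup_(i in `I_n) C i.
have oD n : open (D n).
  apply: openI; first by case: (cC n).
  apply: closed_openC; apply: closed_bigcup => // i _.
  by case: (cC i).
have coverD x : (A `|` B) x -> exists n, D n x.
  move=> ABx; have ex : exists n, `[< C n x >].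
    by exists (f x); apply/asboolP/cover.
  case: (ex_minnP ex) => n /asboolP Cn nmin; exists n; split=> // -[i /= ilt Ci].
  by have := nmin i; rewrite leqNgt ilt => /(_ (asboolT Ci)).
have uniqD m n x : D m x -> D n x -> m = n.
  move=> [Cm nm] [Cn nn]; have [mn|lt_nm|//] := ltngtP m n.
    by case: nn; exists m.
  by case: nm; exists n.
(* Sorting the disjoint pieces by whether [C n] misses [B] makes the two unions disjoint; a piece
   containing a point of [A] must miss [B]. *)
exists (\bigcup_(n in [set n | C n `&` B = set0]) D n).
exists (\bigcup_(n in [set n | C n `&` B <> set0]) D n); split.
- by apply: bigcup_open => n _; exact: oD.
- by apply: bigcup_open => n _; exact: oD.
- move=> x Ax; have [n Dn] := coverD x (or_introl Ax); exists n => //=.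
  have [CA|//] := dC n; have : (C n `&` A) x by split=> //; case: Dn.
  by rewrite CA.
- move=> x Bx; have [n Dn] := coverD x (or_intror Bx); exists n => //= CB.
  have : (C n `&` B) x by split=> //; case: Dn.
  by rewrite CB.
- rewrite -subset0 => x [[m /= mB Dm] [n /= nB Dn]].
  by apply: nB; rewrite -(uniqD _ _ _ Dm Dn).
Qed.

(** * Auxiliary facts on omega + 1 and on entourages *)

Section OmegaPlusOneTopology.
Local Notation Y := (order_topology omega_plus_one).

Lemma nbhs_omega_point (Q : set Y) : nbhs (None : Y) Q -> exists k, Q (Some k).
Proof.
rewrite itv_nbhsE => -[[l r] [/= oi Ni] iQ].
have [k kP] : exists k, (Some k : Y) \in Interval l r; last by exists k; exact: iQ.
move: Ni oi {iQ}; rewrite !itv_boundlr => /andP[].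
(* An open-ended interval around the top has no right bound, so the witness is [0] without a left
   bound and [l.+1] above a left bound [Some l]. *)
case: l => [[] [l|]|[]]; case: r => [[] [r|]|[]] //=; rewrite /itv_open_ends //=; last by exists 0%N.
move=> _ _ _; exists l.+1; rewrite itv_boundlr.
have : (Some l : omega_plus_one) < Some l.+1.
  by rewrite lt_def /Order.le /= leqnSn andbT; apply/eqP => -[] /eqP; rewrite eqn_leq ltnn.
by move=> h; apply/andP; split.
Qed.

End OmegaPlusOneTopology.

Lemma compatible_uniformity_split (X : topologicalType) (E : set_system (X * X)) U :
  compatible_uniformity E -> E U ->
  exists V, [/\ E V, forall x, V (x, x), forall x y, V (x, y) -> V (y, x) &
                forall x y z, V (x, y) -> V (y, z) -> U (x, z)].
Proof.
move=> [FE dE sE tE _] EU; have [V EV VU] := tE U EU.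
exists (V `&` (V^-1)%relation); split.
- by apply: filterI => //; exact: sE.
- by move=> x; split; apply: (dE V EV).
- by move=> x y [].
- by move=> x y z [Vxy _] [Vyz _]; apply: VU; exists y.
Qed.

(** * Bounded closed sets and the Dowker property *)

Section LadderTheory.
Context {d : Order.disp_t} (W : orderType d).
Hypothesis hW : is_omega1 W.
Variable c : W -> nat -> W.
Hypothesis c_lt : forall a k, limit_ordinal a -> c a k < a.
Hypothesis c_mono : forall a, limit_ordinal a ->
  {homo c a : m n / (m < n)%N >-> m < n}.
Hypothesis c_cofinal : forall a b, limit_ordinal a -> b < a -> exists k, b < c a k.
(** This is club-star for the ladders [c], with uncountable read as unbounded and infinite
    intersection read as cofinal in the ladder. *)
Hypothesis c_club : forall A : set W, (forall a, exists2 b, A b & a < b) ->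
  exists2 D, club D & forall a, D a ->
    limit_ordinal a /\ forall b, b < a -> exists2 k, b < c a k & A (c a k).
Local Notation X := (ladder_space c).
Implicit Types (A B : set X) (a b : W).

Definition bounded A := exists a, A `<=` below a.

Lemma bounded_bigcup (F : nat -> set X) :
  (forall n, bounded (F n)) -> bounded (\bigcup_n F n).
Proof.
move=> /choice[f fP].
have cf : countable (range f) by exact: sub_countable (card_image_le _ _) _.
have [a aP] := omega1_countable_bounded hW cf.
by exists a => x [n _ /fP Fx]; apply: le_trans Fx (ltW _); apply: aP; exists n.
Qed.

Lemma not_bounded A : ~ bounded A -> forall a, exists2 x, A x & a < x.1.
Proof.
move=> nA a; apply: contrapT => h; apply: nA; exists a => x Ax.
by rewrite -aboveC => ax; apply: h; exists x.
Qed.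

(** Some level of [A] is unbounded, since a countable union of bounded sets is bounded. Club-star
    then makes [(a, m.+1)] a limit of points [(c a k, m)] of [A] for club many [a], and clubs are
    again unbounded. *)
Lemma closed_unbounded_club A : closed A -> ~ bounded A ->
  exists n, forall m, (n <= m)%N -> exists2 D, club D & forall a, D a -> A (a, m).
Proof.
move=> cA nA.
have [n nP] : exists n, ~ bounded (A `&` [set x | x.2 = n]).
  apply: contrapT => h; apply: nA.
  have := @bounded_bigcup (fun n => A `&` [set x | x.2 = n]).
  case=> [n|a aP]; first by apply: contrapT => nb; apply: h; exists n.
  by exists a => x Ax; apply: aP; exists x.2.
have step m : (forall a, exists2 b, A (b, m) & a < b) ->
    exists2 D, club D & forall a, D a -> A (a, m.+1).
  move=> /c_club[D clD DP]; exists D => // a /DP[la aP].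
  apply: cA => U /ladder_nbhsE[_ /(_ la)[b /= ba bU]].
  have [k bk Ak] := aP b ba; exists (c a k, m); split=> //.
  apply: bU; split=> //; right; split=> //; exists k.
  by split; [exact: fan_top|move=> i; exact: c_mono].
have stepC m : (n < m)%N -> exists2 D, club D & forall a, D a -> A (a, m).
  elim: m => // m IH; rewrite ltnS leq_eqVlt => /orP[/eqP <-|/IH[D [_ uD] DA]].
    by apply: step => a; have [[b k] [Ab /= <-] ab] := not_bounded nP a; exists b.
  by apply: step => a; have [b /DA Ab ab] := uD a; exists b.
(* Level [n] is only known to be unbounded; clubs are available from the next level on. *)
by exists n.+1.
Qed.

Lemma closed_unbounded_meet A B :
  closed A -> closed B -> ~ bounded A -> ~ bounded B -> A `&` B !=set0.
Proof.
move=> cA cB nA nB.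
have [m mP] := closed_unbounded_club cA nA.
have [n nP] := closed_unbounded_club cB nB.
have [D clD DA] := mP (maxn m n) (leq_maxl m n).
have [E clE EB] := nP (maxn m n) (leq_maxr m n).
have [a [/DA Aa /EB Ba]] := club_meet hW clD clE.
by exists (a, maxn m n).
Qed.

Lemma countable_below a : countable (below a : set X).
Proof.
apply: (@sub_countable _ _ _ ([set b | b <= a] `*` [set: nat])).
  by apply: subset_card_le => -[b n] /= ba; split.
by apply: countableX => //; exact: omega1_countable_le.
Qed.

Lemma ladder_normal : normal_space X.
Proof.
apply: normal_space_separation => A B.
(* Two unbounded closed sets would meet, so one of [A] and [B] is bounded. *)
wlog [a aP] : A B / bounded A.
  move=> H cA cB AB.
  have [bA|nbA] := pselect (bounded A); first exact: H.
  have [bB|nbB] := pselect (bounded B).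
    have [|U [V [oU oV BU AV UV]]] := H B A bB cB cA; first by rewrite setIC.
    by exists V, U; split=> //; rewrite setIC.
  by have /set0P := closed_unbounded_meet cA cB nbA nbB; rewrite AB eqxx.
move=> cA cB AB.
have [] := @countable_closed_separation X A (B `&` below a).
- exact: ladder_clopen_base.
- by apply: sub_countable (countable_below a); exact: subset_card_le.
- by apply: sub_countable (countable_below a); apply: subset_card_le => x [].
- by [].
- by apply: closedI => //; exact: closed_below.
- by rewrite setIA AB set0I.
move=> U [V [oU oV AU BV UV]].
(* The part of [B] beyond the bound [a] of [A] is absorbed by the clopen tail. *)
exists (U `&` below a), (V `|` above a); split.
- by apply: openI => //; exact: open_below.
- by apply: openU => //; exact: open_above.
- by move=> x Ax; split; [exact: AU|exact: aP].
- move=> x Bx; have [xa|ax] := leP x.1 a; last by right.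
  by left; apply: BV.
- rewrite -subset0 => x [[Ux xa] [Vx|ax]].
    by have : (U `&` V) x by []; rewrite UV.
  by move: xa; rewrite /below /= leNgt ax.
Qed.

(** The complement of the interior of [U n] is closed and misses all levels from [n] on, hence is
    bounded. The union of these complements is bounded too, and any point beyond it is common. *)
Lemma tail_nbhs_common_point (U : nat -> set X) :
  (forall n (x : X), (n <= x.2)%N -> nbhs x (U n)) -> exists a, forall n, U n (a, 0%N).
Proof.
move=> nU.
have [a aP] : bounded (\bigcup_n ~` (U n)^°).
  apply: bounded_bigcup => n; apply: contrapT => nb.
  have cU : closed (~` (U n)^°) by apply: open_closedC; exact: open_interior.
  have [m mP] := closed_unbounded_club cU nb.
  have [D [_ uD] DP] := mP (maxn m n) (leq_maxl m n).
  have [a0 _] := omega1_nonempty hW.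
  have [b /DP nUb _] := uD a0; apply: nUb.
  exact: (nU n (b, maxn m n) (leq_maxr m n)).
have [b [ab _ _]] := omega1_limit_closed hW id a.
exists b => n; apply: contrapT => nUb.
have nIb : ~ (U n)^° (b, 0%N) by move=> /interior_subset.
have /aP : (\bigcup_n ~` (U n)^°) (b, 0%N) by exists n.
by rewrite /below /= leNgt ab.
Qed.

(** The closed set [K] of pairs [(x, k)] with [k] at most the level of [x] lies in the open set [H]
    of pairs with finite second coordinate. Any neighbourhood of [K] contains all [((a, 0), k)] for
    some [a], so its closure leaves [H] at [((a, 0), None)]. *)
Lemma ladder_prod_not_normal :
  ~ normal_space (X * order_topology omega_plus_one)%type.
Proof.
pose Y := order_topology omega_plus_one.
pose K : set (X * Y) := [set p | exists2 k, p.2 = Some k & (k <= p.1.2)%N].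
pose H : set (X * Y) := [set p | p.2 != None].
move=> /(_ K).
have some_lt (m n : nat) : ((Some m : Y) < Some n) = (m < n)%N.
  by rewrite lt_neqAle /Order.le /= [RHS]ltn_neqAle.
have oray (y : Y) : open [set w : Y | y < w].
  by have := @rray_open _ Y y; rewrite set_itvE.
have olray (y : Y) : open [set w : Y | w < y].
  by have := @lray_open _ Y y; rewrite set_itvE.
have [|cK] := pselect (closed K); last first.
  case: cK => -[x y] clK; apply: contrapT => nK.
  (* For a pair outside [K], the box of [levels x.2] and the ray above [Some x.2] is a neighbourhood
     missing [K]. *)
  have xy : (Some x.2 : Y) < y.
    case: y nK {clK} => [k|] nK //=; rewrite some_lt ltnNge.
    by apply/negP => kx; apply: nK; exists k.
  have [|[z w] [[k /= -> kz] [/= zx]]] := clK (levels x.2 `*` [set w : Y | (Some x.2 : Y) < w]).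
    exists (levels x.2, [set w : Y | (Some x.2 : Y) < w]) => //=; split.
      by apply: open_nbhs_nbhs; split; [exact: open_levels|rewrite /levels /=].
    by apply: open_nbhs_nbhs.
  rewrite some_lt => /(leq_trans)/(_ (leq_trans kz zx)).
  by rewrite ltnn.
move=> cK /(_ cK H).
have [|//] := pselect (set_nbhs K H); last first.
  case=> -[x y] [k /= yk kx]; exists (setT, [set w : Y | w < (None : Y)]) => /=; last first.
    by move=> [z w] [_ /=]; rewrite /H /=; case: w.
  split; first exact: filterT.
  by apply: open_nbhs_nbhs; split; [exact: olray|rewrite yk].
move=> nH /(_ nH)[V VK clV].
have [|a aP] := @tail_nbhs_common_point (fun n => [set x | V (x, Some n)]).
  move=> n x nx; have [[P Q] [/= nP nQ] PQ] : nbhs (x, Some n : Y) V.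
    by apply: VK; exists n.
  apply: filterS nP => z Pz; apply: PQ; split=> //=; exact: nbhs_singleton nQ.
suff /clV : closure V ((a, 0%N), None) by [].
move=> B [[P Q] [/= nP nQ] PQ]; have [k Qk] := nbhs_omega_point nQ.
exists ((a, 0%N), Some k); split; first exact: aP.
by apply: PQ; split=> //=; exact: nbhs_singleton nP.
Qed.

Lemma ladder_Dowker : Dowker_space X.
Proof.
split; first exact: ladder_hausdorff.
- exact: ladder_normal.
- exact: ladder_prod_not_normal.
Qed.

(** * Entourages and a strategy for Player II *)

Variable E : set_system (X * X).
Hypothesis cE : compatible_uniformity E.

Lemma entourage_nbhs V (x : X) : E V -> nbhs x (xsection V x).
Proof. by case: cE => _ _ _ _ -> EV; exists V. Qed.

(* If all sections were bounded, take [a] closed under their bounds: [(a, 1)] is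
close to some [(c a k, 0)], whose section lies below [a]. *)
Lemma entourage_unbounded_section V : E V -> exists x, ~ bounded (xsection V x).
Proof.
move=> /(compatible_uniformity_split cE)[V' [EV' rV' sV' VV']].
apply: contrapT => /forallNP h.
have /choice[f fP] : forall b, exists a, xsection V (b, 0%N) `<=` below a.
  by move=> b; exact: contrapT (h (b, 0%N)).
have [a0 _] := omega1_nonempty hW.
have [a [_ la af]] := omega1_limit_closed hW f a0.
have /ladder_nbhsE[_ /(_ la)[b /= ba bV]] := @entourage_nbhs V' (a, 1%N) EV'.
have [k bk] := c_cofinal la ba.
have /xsectionP/sV' kV : xsection V' (a, 1%N) (c a k, 0%N).
  apply: bV; split=> //; right; split=> //; exists k; split=> // i.
  exact: c_mono.
have : xsection V (c a k, 0%N) (a, 1%N) by apply/xsectionP; exact: VV' (rV' _).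
by move=> /fP; rewrite /below /= leNgt af// c_lt.
Qed.

(** For an unbounded section [V3[x]], the complement of [V1[x]] must be bounded, because the
    closures of these two sets are disjoint. Points beyond the bound are all [V1]-close to [x]. *)
Lemma entourage_above U : E U ->
  exists a, forall x y : X, a < x.1 -> a < y.1 -> U (x, y).
Proof.
move=> /(compatible_uniformity_split cE)[V1 [EV1 rV1 sV1 U1]].
have [V2 [EV2 rV2 sV2 U2]] := compatible_uniformity_split cE EV1.
have [V3 [EV3 rV3 sV3 U3]] := compatible_uniformity_split cE EV2.
have [x nx] := entourage_unbounded_section EV3.
(* A common point [y] is [V3]-close to some [z] in [V3[x]] and to some [w] outside [V1[x]]; the
   chain [x], [z], [y], [w] puts [w] in [V1[x]]. *)
have disj : closure (xsection V3 x) `&` closure (~` xsection V1 x) = set0.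
  rewrite -subset0 => y [clx cly].
  have [z [/xsectionP xz /xsectionP yz]] := clx _ (entourage_nbhs y EV3).
  have [w [nxw /xsectionP yw]] := cly _ (entourage_nbhs y EV3).
  apply: nxw; apply/xsectionP; apply: (U2 _ y).
    exact: U3 xz (sV3 _ _ yz).
  exact: U3 yw (rV3 _).
have [a aP] : bounded (~` xsection V1 x).
  apply: contrapT => nb.
  have [||y] := @closed_unbounded_meet _ _
    (@closed_closure _ (xsection V3 x)) (@closed_closure _ (~` xsection V1 x)).
  - by move=> [a aP]; apply: nx; exists a => y /subset_closure/aP.
  - by move=> [a aP]; apply: nb; exists a => y /subset_closure/aP.
  by rewrite disj.
have aV (y : X) : a < y.1 -> V1 (x, y).
  by move=> ay; apply/xsectionP; apply: contrapT => /aP; rewrite /below /= leNgt ay.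
by exists a => y z ay az; apply: (U1 _ x); [exact/sV1/aV|exact: aV].
Qed.

Lemma ladder_winningII : exists s, winningII E s.
Proof.
have [a0 _] := omega1_nonempty hW.
have /choice[h hP] : forall U, exists a, E U ->
    forall x y : X, a < x.1 -> a < y.1 -> U (x, y).
  move=> U; have [/entourage_above[a aP]|nU] := pselect (E U); first by exists a.
  by exists a0.
have bd (g : nat -> W) : exists b, forall i, g i < b.
  have cg : countable (range g) by exact: sub_countable (card_image_le _ _) _.
  by have [b bP] := omega1_countable_bounded hW cg; exists b => i; apply: bP; exists i.
(* [f us] exceeds the thresholds of all entourages played so far; indices past the end only add the
   threshold of the default [setT]. *)
have /choice[f fP] : forall us : seq (set (X * X)), exists b,
    forall i, h (nth setT us i) < b by move=> us; exact: bd.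
(* The move of inning [n] is on level [n.+1]. *)
exists (fun us => (f us, size us)) => U [EU _].
have hf i n : (i <= n)%N -> h (U i) < f (mkseq U n.+1).
  by move=> ni; have := fP (mkseq U n.+1) i; rewrite nth_mkseq.
split.
  move=> n; apply/xsectionP; apply: hP => //; apply: hf => //.
rewrite /playII; case=> [ne0|[[a m] cv]].
  (* A point beyond the thresholds of all [U n] lies in every section. *)
  have [b bP] := bd (h \o U).
  suff : (\bigcap_n xsection (U n) (f (mkseq U n.+1), size (mkseq U n.+1)))
     ((b, 0%N) : X) by rewrite ne0.
  by move=> n _; apply/xsectionP; apply: hP => //; [exact: hf|exact: bP].
(* A limit [(a, m)] would keep the play eventually within the levels up to [m], but inning
   [maxn N m] is already above them. *)
have : nbhs ((a, m) : X) (levels m).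
  by apply: open_nbhs_nbhs; split; [exact: open_levels|rewrite /levels /=].
move=> /cv[N _ /(_ (maxn N m))] /=; rewrite leq_maxl => /(_ isT).
by rewrite /levels /= size_map size_iota ltnNge leq_maxr.
Qed.

End LadderTheory.

(** * From club-star to the ladders *)

(** Otherwise [A] would lie in the image of the indices below [m], which is finite. *)
Lemma card_nat_subset_range (T : Type) (A : set T) (g : nat -> T) m :
  A `<=` range g -> A #= [set: nat] -> exists2 k, (m <= k)%N & A (g k).
Proof.
move=> Ag An; apply: contrapT => h; apply: infinite_nat.
rewrite -(eq_finite_set An); apply: (@sub_finite_set _ _ (g @` `I_m)).
  move=> x Ax; have [k _ gk] := Ag x Ax; exists k => //=.
  by rewrite ltnNge; apply/negP => mk; apply: h; exists k => //; rewrite gk.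
exact: finite_image.
Qed.

Theorem mainTheorem1 (d : Order.disp_t) (W : orderType d)
    (hW : is_omega1 W) (hclub : club_star W) :
  exists X : topologicalType,
    [/\ first_countable X, locally_compact [set: X], Dowker_space X &
        ~ semi_proximal X].
Proof.
have [C [CP Cclub]] := hclub.
(* [c a] enumerates [C a] increasingly; at non-limits the constant [a] is a placeholder. *)
have /choice[c cP] : forall a, exists g : nat -> W, limit_ordinal a ->
    {homo g : m n / (m < n)%N >-> m < n} /\ range g = C a.
  move=> a; have [la|nla] := pselect (limit_ordinal a).
    by have [_ [g gP] _] := CP a la; exists g.
  by exists (fun=> a).
have c_mono a : limit_ordinal a -> {homo c a : m n / (m < n)%N >-> m < n}.
  by move=> /cP[].
have c_lt a k : limit_ordinal a -> c a k < a.
  move=> la; have [Ca _ _] := CP a la; apply: Ca.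
  by have [_ <-] := cP a la; exists k.
have c_cofinal a b : limit_ordinal a -> b < a -> exists k, b < c a k.
  move=> la ba; have [_ _ [_ aC]] := CP a la; apply: contrapT => /forallNP h.
  suff /aC : ubound (C a) b by rewrite leNgt ba.
  have [_ <-] := cP a la => _ [k _ <-].
  by rewrite leNgt; exact/negP/h.
have c_club (A : set W) : (forall a, exists2 b, A b & a < b) ->
  exists2 D, club D & forall a, D a ->
    limit_ordinal a /\ forall b, b < a -> exists2 k, b < c a k & A (c a k).
  move=> uA; have [|D clD DP] := Cclub A.
    move=> /(omega1_countable_bounded hW)[a aP].
    by have [b /aP ba /(lt_trans ba)] := uA a; rewrite ltxx.
  exists D => // a /DP[la An]; split=> // b ba.
  (* Beyond index [m] the ladder exceeds [b], and [A] meets it infinitely often, so some index from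
     [m] on serves. *)
  have [m bm] := c_cofinal a b la ba.
  have [|k mk [Ak _]] := @card_nat_subset_range _ _ (c a) m _ An.
    by have [_ <-] := cP a la => x [].
  exists k => //; apply: lt_le_trans bm _.
  by move: mk; rewrite leq_eqVlt => /orP[/eqP -> //|/c_mono/ltW]; exact.
exists (ladder_space c); split.
- exact: ladder_first_countable.
- exact: ladder_locally_compact.
- exact: ladder_Dowker.
- by move=> [E cE]; apply; exact: ladder_winningII.
Qed.
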